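(* Let $A\in\mathbb{R}^{m\times n}$ with $\operatorname{rank}(A)=m$, $b\in\mathbb{R}^m$, $c\in\mathbb{R}^n$, and suppose that the linear program $\min\{c^Tx : Ax=b,\ x\ge 0\}$ has an optimal solution. Let $\delta$ and $\gamma$ be the minimum and the maximum values of all the positive elements of basic feasible solutions of this program. If this (primal) program is nondegenerate, then the simplex method with the most negative rule or the best improvement rule, started from an initial basic feasible solution $x^0$, finds an optimal solution in at most $$n\left\lceil m\frac{\gamma}{\delta}\log\left(m\frac{\gamma}{\delta}\right)\right\rceil$$ iterations.
   Context: For $a\in\mathbb{R}$, $\lceil a\rceil$ denotes the smallest integer bigger than $a$; $\log$ is the natural logarithm. Bases and basic feasible solutions: $\mathcal{B}=\{B\subset\{1,\dots,n\} : |B|=m,\ \det(A_B)\neq 0\}$, where $A_B$ is the submatrix of columns indexed by $B$. For $B\in\mathcal{B}$ and $N=\{1,\dots,n\}-B$, the vector with $x_B=A_B^{-1}b$, $x_N=0$ is a basic feasible solution (BFS) if $x_B\ge 0$. The program is nondegenerate if $x_B>0$ for every BFS and its basis $B$. Every nonzero component $\hat x_j$ of any BFS $\hat x$ satisfies $\delta\le\hat x_j\le\gamma$. Simplex method: the $t$-th iterate $x^t$ is the BFS of a basis $B^t\in\mathcal{B}$, with $N^t=\{1,\dots,n\}-B^t$. The reduced cost vector is $\bar c_{N^t}=c_{N^t}-A_{N^t}^T(A_{B^t}^{-1})^Tc_{B^t}$. If $\bar c_{N^t}\ge 0$, the current solution is optimal and the method stops. Otherwise a pivot (one iteration) is conducted: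 one nonbasic variable (entering variable) is chosen and increased, with the other nonbasic variables kept at zero and $x_{B^t}=A_{B^t}^{-1}b-A_{B^t}^{-1}A_{N^t}x_{N^t}$, until one basic variable (leaving variable) becomes zero; then the two variables are exchanged, giving $B^{t+1}$ and $x^{t+1}$. Most negative rule (Dantzig's rule): the entering index is $j^t_{MN}=\arg\min_{j\in N^t}\bar c_j$. Best improvement rule: the entering variable is chosen so that the objective value at the next iterate is minimum. *)

(* Defs.v *)
From HB Require Import structures.
From mathcomp Require Import all_boot all_order all_algebra.
From mathcomp Require Import classical_sets reals exp.

Set Implicit Arguments.
Unset Strict Implicit.
Unset Printing Implicit Defensive.

Import Order.TTheory GRing.Theory Num.Theory.
Local Open Scope ring_scope.

(* "Smallest integer bigger than a", with a strict "bigger": it is a + 1, not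
   a, when a is an integer (see strict_ceilP). *)
Definition strict_ceil (R : realType) (a : R) : int := Num.floor a + 1.

Lemma strict_ceilP (R : realType) (a : R) :
  a < (strict_ceil a)%:~R /\
  forall z : int, a < z%:~R -> strict_ceil a <= z.
Proof.
split; first exact: floorD1_gt.
by move=> z; rewrite -floor_lt_int -lezD1.
Qed.

Section LinearProgram.
Variables (R : realType) (m n : nat).
Variables (A : 'M[R]_(m, n)) (b : 'cV[R]_m) (c : 'cV[R]_n).
Implicit Types (B : {set 'I_n}) (x y : 'cV[R]_n).

Definition objective x : R := (c^T *m x) 0 0.

Definition feasible x : Prop := A *m x = b /\ forall j, 0 <= x j 0.

Definition optimal x : Prop :=
  feasible x /\ forall y, feasible y -> objective x <= objective y.

(* A_B and v_B, listed in increasing order of the indices in B.  conform_mx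
   turns the width (resp. height) #|B| into m; the default value 0 is only
   taken when #|B| != m. *)
Definition basic_mx B : 'M[R]_m :=
  conform_mx 0 (colsub (fun k : 'I_#|B| => enum_val k) A).

Definition basic_vec B (v : 'cV[R]_n) : 'cV[R]_m :=
  conform_mx 0 (rowsub (fun k : 'I_#|B| => enum_val k) v).

(* A_N and v_N for N = ~: B. *)
Definition nonbasic_mx B : 'M[R]_(m, #|~: B|) :=
  colsub (fun k : 'I_#|~: B| => enum_val k) A.

Definition nonbasic_vec B (v : 'cV[R]_n) : 'cV[R]_#|~: B| :=
  rowsub (fun k : 'I_#|~: B| => enum_val k) v.

Definition is_basis B : bool := (#|B| == m) && (\det (basic_mx B) != 0).

Definition bfs_of B x : Prop :=
  [/\ is_basis B,
      basic_vec B x = invmx (basic_mx B) *m b,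
      nonbasic_vec B x = 0
    & forall i, 0 <= basic_vec B x i 0].

Definition bfs x : Prop := exists B, bfs_of B x.

Definition lp_nondegenerate : Prop :=
  forall B x, bfs_of B x -> forall i, 0 < basic_vec B x i 0.

Definition bfs_positive_elements : set R :=
  [set v | 0 < v /\ exists x j, bfs x /\ v = x j 0]%classic.

Definition reduced_cost B : 'cV[R]_#|~: B| :=
  nonbasic_vec B c
    - (nonbasic_mx B)^T *m (invmx (basic_mx B))^T *m basic_vec B c.

Definition stopping_test B : Prop := forall k, 0 <= reduced_cost B k 0.

(* An entering variable is given by its position k in the enumeration of
   ~: B; its index in 'I_n is enum_val k.  [on_edge B k theta y]: y is the
   point reached from the basic solution of B when the entering variable has
   been increased to theta. *)
Definition on_edge B (k : 'I_#|~: B|) (theta : R) y : Prop :=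
  nonbasic_vec B y = theta *: delta_mx k 0 /\
  basic_vec B y =
    invmx (basic_mx B) *m b
      - invmx (basic_mx B) *m nonbasic_mx B *m nonbasic_vec B y.

(* The entering variable is increased until the basic variable i becomes zero
   and blocks any further increase.  The blocking condition is automatic when
   the basic variables are positive at the start; in a degenerate program it
   discards the basic variables that are zero but do not decrease. *)
Definition pivot B (k : 'I_#|~: B|) B' x' : Prop :=
  exists (theta : R) (i : 'I_n),
    [/\ 0 <= theta,
        on_edge k theta x' /\ (forall j, 0 <= x' j 0),
        i \in B /\ x' i 0 = 0,
        forall theta' y, theta < theta' -> on_edge k theta' y -> y i 0 < 0
      & B' = enum_val k |: (B :\ i)].

Inductive pivot_rule := MostNegative | BestImprovement.

(* Ties in the choices of the entering and leaving variables are broken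
   arbitrarily, hence a relation. *)
Definition rule_ok (rule : pivot_rule) B (k : 'I_#|~: B|) x' : Prop :=
  match rule with
  | MostNegative => forall l, reduced_cost B k 0 <= reduced_cost B l 0
  | BestImprovement =>
      forall l B'' x'', @pivot B l B'' x'' -> objective x' <= objective x''
  end.

Definition iteration (rule : pivot_rule) B B' x' : Prop :=
  ~ stopping_test B /\
  exists k : 'I_#|~: B|, pivot k B' x' /\ rule_ok rule k x'.

Definition simplex_run (rule : pivot_rule) x0 (T : nat)
    (B : nat -> {set 'I_n}) (x : nat -> 'cV[R]_n) : Prop :=
  [/\ x 0%N = x0,
      bfs_of (B 0%N) (x 0%N)
    & forall t, (t < T)%N -> iteration rule (B t) (B t.+1) (x t.+1)].

(* Whatever the choices made, the method from x0 performs at most K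
   iterations, is never stuck before the stopping test succeeds, and its
   iterate is optimal when it stops. *)
Definition finds_optimal_within (rule : pivot_rule) x0 (K : int) : Prop :=
  forall (T : nat) (B : nat -> {set 'I_n}) (x : nat -> 'cV[R]_n),
    simplex_run rule x0 T B x ->
    [/\ T%:Z <= K,
        stopping_test (B T) -> optimal (x T)
      & ~ stopping_test (B T) ->
          exists B' x', iteration rule (B T) B' x'].

End LinearProgram.

(* Main.v *)
Require Import Defs.
From HB Require Import structures.
From mathcomp Require Import all_boot all_order all_algebra.
From mathcomp Require Import boolp classical_sets reals sequences exp.
From mathcomp Require Import ring lra.

(** Write [k = m gamma / delta], and call the gap of a basic feasible solution
(BFS) the excess of its objective value over the optimal one.  The bound comes
from two facts about the gap, both obtained from slack vectors: a basis [B]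
yields a vector [s], equal to the reduced costs off [B] and to 0 on [B], such
that the objective at any solution of [A x = b] is a constant plus the inner
product of [s] and [x].

Every iteration multiplies the gap by at most [1 - 1/k] ([iteration_progress]).
Indeed, if [- r] is the most negative reduced cost, comparing the current slack
with an optimal BFS, whose entries add up to at most [m gamma], shows that the
gap is at most [r m gamma]; entering the corresponding variable, which reaches
a positive and hence at least [delta] value by nondegeneracy, lowers the
objective by at least [r delta].  The best improvement rule does at least as
well as this pivot.

Now let [ss >= 0] be the slack of an optimal basis, so that the gap of [x] is
the inner product of [ss] and [x].  At an iterate [x] with a positive gap, some
basic [j] carries at least the share [gap / m] of this inner product.  Since
[x_j <= gamma], the coefficient [ss_j] is at least [gap / (m gamma)], so a later
BFS [y] with [y_j > 0], hence [y_j >= delta], has a gap of at least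
[ss_j delta >= gap x / k] ([vanishing_variable]).  After [r > k ln k]
iterations the gap has been multiplied by less than [1/k] ([pow_decay]), and
[x_j] is zero from then on.  Each block of [r] iterations thus kills for good a
variable that was alive at its beginning, and there are [n] variables
([phase_count]).

An optimal basis with a nonnegative slack is needed for the above.  It is
obtained from the method itself: at a BFS with the least objective, a negative
reduced cost would allow a strictly improving pivot ([optimal_bfs_exists]),
because the linear program is bounded ([pivot_exists]). *)

Set Implicit Arguments.
Unset Strict Implicit.
Unset Printing Implicit Defensive.

Import Order.TTheory GRing.Theory Num.Theory.
Local Open Scope ring_scope.

(** * Minima over finite families *)

(** Tailored to finding the best object when each index (here, a basis)
determines at most one object, but possibly none. *)
Lemma finite_argmin disp (R : orderType disp) (I : finType) (T : choiceType)
    (P : I -> T -> Prop) (f : T -> R) :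
  (forall i x y, P i x -> P i y -> x = y) ->
  (exists i x, P i x) ->
  exists i x, P i x /\ forall j y, P j y -> (f x <= f y)%O.
Proof.
move=> P_inj [i0 [x0 Px0]].
pose g i := xget x0 [set x | P i x]%classic.
have gP i x : P i x -> P i (g i).
  by move=> Px; apply: (@xgetPex _ x0 [set x | P i x]%classic); exists x.
have Pi0 : `[< exists x, P i0 x >] by apply/asboolP; exists x0.
case: (@Order.TotalTheory.arg_minP _ _ _ i0 (fun i => `[< exists x, P i x >])
         (f \o g) Pi0) => i /asboolP [x Px] i_min.
exists i, (g i); split=> [|j y Py]; first exact: gP Px.
rewrite -(P_inj j (g j) y) //; last exact: gP Py.
by apply: i_min; apply/asboolP; exists y.
Qed.

(** * Bases, slack vectors and pivots *)

Section Bases.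
Variables (R : realType) (m n : nat).
Variables (A : 'M[R]_(m, n)) (b : 'cV[R]_m) (c : 'cV[R]_n).
Implicit Types (B : {set 'I_n}) (v w x y s : 'cV[R]_n).

Definition supported B v : Prop := forall j, j \notin B -> v j 0 = 0.

(** Enumerates [B] by ['I_m] instead of ['I_#|B|], which removes the casts of
[basic_mx] and [basic_vec]. *)
Definition basis_index B (cardB : #|B| = m) (i : 'I_m) : 'I_n :=
  enum_val (cast_ord (esym cardB) i).

Lemma basis_indexP B (cardB : #|B| = m) i : basis_index cardB i \in B.
Proof. exact: enum_valP. Qed.

Lemma basis_index_onto B (cardB : #|B| = m) j :
  j \in B -> exists i, j = basis_index cardB i.
Proof.
move=> jB; exists (cast_ord cardB (enum_rank_in jB j)).
by rewrite /basis_index cast_ordK enum_rankK_in.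
Qed.

Lemma nonbasic_index_onto B j :
  j \notin B -> exists k : 'I_#|~: B|, j = enum_val k.
Proof.
move=> jB; have jN : j \in ~: B by rewrite inE.
by exists (enum_rank_in jN j); rewrite enum_rankK_in.
Qed.

Lemma nonbasic_indexP B (k : 'I_#|~: B|) : enum_val k \notin B.
Proof. by have := enum_valP k; rewrite inE. Qed.

Lemma basic_mxE B (cardB : #|B| = m) :
  basic_mx A B = colsub (basis_index cardB) A.
Proof.
rewrite /basic_mx -(conform_castmx (erefl, cardB)) conform_mx_id.
apply/matrixP => i j; rewrite castmxE !mxE; congr (A _ _).
exact: cast_ord_id.
Qed.

Lemma basic_vecE B (cardB : #|B| = m) v :
  basic_vec m B v = rowsub (basis_index cardB) v.
Proof.
rewrite /basic_vec -(conform_castmx (cardB, erefl)) conform_mx_id.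
apply/matrixP => i j; rewrite castmxE !mxE; congr (v _ _).
exact: cast_ord_id.
Qed.

Lemma nonbasic_vec_eq0 B v : nonbasic_vec B v = 0 <-> supported B v.
Proof.
split=> [v0 j /nonbasic_index_onto [k ->]|v0].
  by have /matrixP/(_ k 0) := v0; rewrite !mxE.
by apply/matrixP => k i; rewrite !mxE (ord1 i) v0 // nonbasic_indexP.
Qed.

Lemma mulmx_split_basis B v (cardB : #|B| = m) :
  A *m v = basic_mx A B *m basic_vec m B v
           + nonbasic_mx A B *m nonbasic_vec B v.
Proof.
rewrite (basic_mxE cardB) (basic_vecE cardB); apply/matrixP => i j.
rewrite !mxE (bigID (mem B)) /=; congr (_ + _).
  rewrite big_enum_val /= (reindex (cast_ord (esym cardB))) /=.
    by apply: eq_bigr => k _; rewrite !mxE.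
  apply: onW_bij.
  by exists (cast_ord cardB) => k; rewrite ?cast_ordKV ?cast_ordK //.
rewrite (eq_bigl (fun k => k \in ~: B)) => [|k]; last by rewrite inE.
by rewrite big_enum_val /=; apply: eq_bigr => k _; rewrite !mxE.
Qed.

Lemma is_basis_card B : is_basis A B -> #|B| = m.
Proof. by case/andP => /eqP. Qed.

Lemma basis_unit B : is_basis A B -> basic_mx A B \in unitmx.
Proof. by case/andP => _; rewrite unitmxE unitfE. Qed.

Lemma basic_nonbasic_eq B v w (cardB : #|B| = m) :
  basic_vec m B v = basic_vec m B w -> nonbasic_vec B v = nonbasic_vec B w ->
  v = w.
Proof.
rewrite !(basic_vecE cardB) => /matrixP eqB /matrixP eqN.
apply/matrixP => j l; rewrite (ord1 l); have [jB|jN] := boolP (j \in B).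
  have [i ->] := basis_index_onto cardB jB.
  by have := eqB i 0; rewrite !mxE.
by have [k ->] := nonbasic_index_onto jN; have := eqN k 0; rewrite !mxE.
Qed.

(** The equations defining both the basic solution and the edges leaving it are
[A v = b] solved for the basic variables. *)
Lemma basic_solutionP B v (basisB : is_basis A B) :
  A *m v = b <->
  basic_vec m B v = invmx (basic_mx A B) *m b
     - invmx (basic_mx A B) *m nonbasic_mx A B *m nonbasic_vec B v.
Proof.
have unitB := basis_unit basisB.
rewrite (mulmx_split_basis v (is_basis_card basisB)); split=> [<-|->].
  by rewrite mulmxDr mulKmx // mulmxA addrK.
by rewrite mulmxBr !mulmxA mulmxV // !mul1mx subrK.
Qed.

(** With its converse [free_is_basis], replaces the determinant of [A_B] by
linear independence of the columns, which is easy to follow through a basis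
exchange. *)
Lemma basis_free B v (basisB : is_basis A B) :
  supported B v -> A *m v = 0 -> v = 0.
Proof.
move=> /nonbasic_vec_eq0 vN Av0; have cardB := is_basis_card basisB.
have vB : basic_vec m B v = 0.
  have := mulmx_split_basis v cardB; rewrite Av0 vN mulmx0 addr0 => eq0.
  by rewrite -[LHS](mulKmx (basis_unit basisB)) -eq0 mulmx0.
apply: (basic_nonbasic_eq cardB); rewrite ?vB ?vN.
  by rewrite (basic_vecE cardB); apply/matrixP => i j; rewrite !mxE.
by apply/matrixP => i j; rewrite !mxE.
Qed.

Lemma basic_nonbasic_surj B (cardB : #|B| = m) (w : 'cV[R]_m)
    (z : 'cV[R]_#|~: B|) :
  exists v, basic_vec m B v = w /\ nonbasic_vec B v = z.
Proof.
have entry j : exists r : R,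
    (forall i, basis_index cardB i = j -> w i 0 = r) /\
    (forall k : 'I_#|~: B|, enum_val k = j -> z k 0 = r).
  have [jB|jN] := boolP (j \in B).
    have [i ->] := basis_index_onto cardB jB; exists (w i 0); split=> [i'|k ek].
      by move=> /enum_val_inj /cast_ord_inj ->.
    by have := nonbasic_indexP k; rewrite ek basis_indexP.
  have [k jk] := nonbasic_index_onto jN; exists (z k 0); split=> [i ij|k'].
    by move: jN; rewrite -ij basis_indexP.
  by rewrite jk => /enum_val_inj ->.
have [g gP] := choice entry; exists (\col_j g j).
rewrite (basic_vecE cardB); split; apply/matrixP => i l; rewrite !mxE (ord1 l).
  by have [-> //] := gP (basis_index cardB i).
by have [_ -> //] := gP (enum_val i).
Qed.

Lemma free_is_basis B :
  #|B| = m -> (forall v, supported B v -> A *m v = 0 -> v = 0) ->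
  is_basis A B.
Proof.
move=> cardB freeB; rewrite /is_basis cardB eqxx /= -det_tr.
apply/det0P => -[u /eqP u0 uA]; apply: u0.
have [v [vB vN]] := basic_nonbasic_surj cardB u^T 0.
have v0 : v = 0.
  apply: freeB; first exact/nonbasic_vec_eq0.
  rewrite (mulmx_split_basis v cardB) vN mulmx0 addr0 vB.
  by rewrite -[LHS]trmxK trmx_mul trmxK uA trmx0.
rewrite -[u]trmxK -vB v0 (basic_vecE cardB).
by apply/matrixP => i j; rewrite !mxE.
Qed.

Lemma bfs_ofP B x (basisB : is_basis A B) :
  bfs_of A b B x <-> [/\ A *m x = b, supported B x & forall j, 0 <= x j 0].
Proof.
have cardB := is_basis_card basisB.
split=> [[_ xB xN x_ge0]|[Ax xN x_ge0]].
  have suppx := (nonbasic_vec_eq0 B x).1 xN; split=> //.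
    by apply/(basic_solutionP x basisB); rewrite xB xN mulmx0 subr0.
  move=> j; have [jB|/suppx -> //] := boolP (j \in B).
  have [i ->] := basis_index_onto cardB jB.
  by have := x_ge0 i; rewrite (basic_vecE cardB) !mxE.
have xN0 := (nonbasic_vec_eq0 B x).2 xN; split=> //.
  by move/(basic_solutionP x basisB): Ax; rewrite xN0 mulmx0 subr0.
by move=> i; rewrite (basic_vecE cardB) !mxE.
Qed.

Lemma bfs_of_basis B x : bfs_of A b B x -> is_basis A B.
Proof. by case. Qed.

Lemma bfs_of_feasible B x : bfs_of A b B x -> feasible A b x.
Proof.
by move=> xB; have [] := (bfs_ofP x (bfs_of_basis xB)).1 xB.
Qed.

Lemma bfs_of_supported B x : bfs_of A b B x -> supported B x.
Proof.
by move=> xB; have [] := (bfs_ofP x (bfs_of_basis xB)).1 xB.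
Qed.

Lemma bfs_of_inj B x y : bfs_of A b B x -> bfs_of A b B y -> x = y.
Proof.
move=> xB yB; have cardB := is_basis_card (bfs_of_basis xB).
case: xB => _ xB xN _; case: yB => _ yB yN _.
by apply: (basic_nonbasic_eq cardB); rewrite ?xB ?yB ?xN ?yN.
Qed.

Lemma nondegenerate_pos B x j :
  lp_nondegenerate A b -> bfs_of A b B x -> j \in B -> 0 < x j 0.
Proof.
move=> nondeg xB jB; have cardB := is_basis_card (bfs_of_basis xB).
have [i ->] := basis_index_onto cardB jB.
by have := nondeg _ _ xB i; rewrite (basic_vecE cardB) !mxE.
Qed.

Definition dot (v w : 'cV[R]_n) : R := \sum_j v j 0 * w j 0.

(** The reduced costs extended by zero to all the variables.  The constant [z]
is the objective value of the basic solution of [B]. *)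
Definition is_slack B s : Prop :=
  [/\ forall j, j \in B -> s j 0 = 0,
      forall k, reduced_cost A c B k 0 = s (enum_val k) 0
    & exists z, forall y, A *m y = b -> objective c y = z + dot s y].

(** With the multipliers [p = A_B^-T c_B], the vector [c - A^T p] has these
properties: the constant is [p^T b]. *)
Lemma slack_exists B : is_basis A B -> exists s, is_slack B s.
Proof.
move=> basisB; have cardB := is_basis_card basisB.
pose p := (invmx (basic_mx A B))^T *m basic_vec m B c.
exists (c - A^T *m p); split.
- move=> j jB; have [i ->] := basis_index_onto cardB jB.
  have pB : basic_vec m B c = (basic_mx A B)^T *m p.
    by rewrite /p mulmxA -trmx_mul mulVmx ?basis_unit // trmx1 mul1mx.
  move: pB; rewrite (basic_vecE cardB) (basic_mxE cardB).
  move=> /matrixP/(_ i 0); rewrite !mxE => ->.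
  by apply/eqP; rewrite subr_eq0; apply/eqP/eq_bigr => l _; rewrite !mxE.
- move=> k; rewrite /reduced_cost -mulmxA -/p !mxE; congr (_ - _).
  by apply: eq_bigr => l _; rewrite !mxE.
- exists ((p^T *m b) 0 0) => y <-.
  have -> : dot (c - A^T *m p) y = ((c - A^T *m p)^T *m y) 0 0.
    by rewrite mxE; apply: eq_bigr => j _; rewrite !mxE.
  rewrite linearB /= (trmx_mul A^T) trmxK mulmxBl -mulmxA /objective.
  have sub00 (M N : 'M[R]_1) : (M - N) 0 0 = M 0 0 - N 0 0 by rewrite !mxE.
  by rewrite sub00 addrCA subrr addr0.
Qed.

Lemma slack_objective B s x y :
  is_slack B s -> bfs_of A b B x -> A *m y = b ->
  objective c y = objective c x + dot s y.
Proof.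
move=> [sB _ [z zP]] xB Ay; rewrite (zP y Ay).
have [Ax _] := bfs_of_feasible xB; rewrite (zP x Ax).
suff -> : dot s x = 0 by rewrite addr0.
apply: big1 => j _; have [jB|jN] := boolP (j \in B).
  by rewrite sB // mul0r.
by rewrite (bfs_of_supported xB) // mulr0.
Qed.

Lemma stopping_slack B s : is_slack B s ->
  stopping_test A c B <-> forall j, 0 <= s j 0.
Proof.
move=> [sB sN _]; split=> [stop j|s_ge0 k]; last by rewrite sN.
have [jB|/nonbasic_index_onto [k ->]] := boolP (j \in B).
  by rewrite sB.
by rewrite -sN.
Qed.

Lemma dot_ge0 v w :
  (forall j, 0 <= v j 0) -> (forall j, 0 <= w j 0) -> 0 <= dot v w.
Proof. by move=> v0 w0; apply: sumr_ge0 => j _; rewrite mulr_ge0. Qed.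

(** Weak duality: a nonnegative slack only adds to the objective. *)
Lemma stopping_optimal B x :
  bfs_of A b B x -> stopping_test A c B -> optimal A b c x.
Proof.
move=> xB stop; have [s sP] := slack_exists (bfs_of_basis xB).
split=> [|y [Ay y_ge0]]; first exact: bfs_of_feasible xB.
rewrite (slack_objective sP xB Ay) lerDl.
by apply: dot_ge0 => //; apply/(stopping_slack sP).
Qed.

(** Increasing the entering variable [q] from 0 to [theta] moves the basic
solution by [theta *: d] for this vector [d]. *)
Definition is_direction B (q : 'I_n) d : Prop :=
  [/\ A *m d = 0, d q 0 = 1 & supported (q |: B) d].

Lemma edge_direction_exists B (k : 'I_#|~: B|) :
  is_basis A B -> exists d, is_direction B (enum_val k) d.
Proof.
move=> basisB; have cardB := is_basis_card basisB.
pose w : 'cV[R]_m :=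
  - (invmx (basic_mx A B) *m nonbasic_mx A B *m delta_mx k 0).
have [d [dB dN]] := basic_nonbasic_surj cardB w (delta_mx k 0).
exists d; split.
- rewrite (mulmx_split_basis d cardB) dB dN /w mulmxN !mulmxA.
  by rewrite mulmxV ?basis_unit // mul1mx addNr.
- by move/matrixP/(_ k 0): dN; rewrite !mxE !eqxx.
- move=> j; rewrite !inE negb_or => /andP[jk /nonbasic_index_onto [l jl]].
  move/matrixP/(_ l 0): dN; rewrite !mxE -jl => ->.
  by case: eqP => // lk; rewrite jl lk eqxx in jk.
Qed.

Lemma on_edgeP B x (k : 'I_#|~: B|) d theta y :
  bfs_of A b B x -> is_direction B (enum_val k) d ->
  on_edge A b k theta y <-> y = x + theta *: d.
Proof.
move=> xB [Ad dk dN]; have basisB := bfs_of_basis xB.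
have cardB := is_basis_card basisB.
have [Ax _] := bfs_of_feasible xB.
have dNE : nonbasic_vec B d = delta_mx k 0.
  apply/matrixP => l i; rewrite !mxE (ord1 i) eqxx andbT.
  have [->|lk] := eqVneq l k; first exact: dk.
  apply: dN; rewrite !inE negb_or nonbasic_indexP andbT.
  by apply: contraNneq lk => /enum_val_inj ->.
have xN : nonbasic_vec B x = 0.
  by apply/nonbasic_vec_eq0; exact: bfs_of_supported xB.
have edgeN : nonbasic_vec B (x + theta *: d) = theta *: delta_mx k 0.
  have <- : nonbasic_vec B x + theta *: nonbasic_vec B d
            = nonbasic_vec B (x + theta *: d).
    by apply/matrixP => i j; rewrite !mxE.
  by rewrite xN dNE add0r.
have edgeA : A *m (x + theta *: d) = b.
  by rewrite mulmxDr -scalemxAr Ad scaler0 addr0.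
split=> [[yN yB]|->]; last first.
  by split=> //; apply/(basic_solutionP _ basisB).
apply: (basic_nonbasic_eq cardB); last by rewrite yN.
by rewrite yB yN -edgeN; symmetry; apply/(basic_solutionP _ basisB).
Qed.

Lemma is_slack_out B s q : is_slack B s -> s q 0 < 0 -> q \notin B.
Proof.
by move=> [sB _ _] sq; apply/negP => /sB sq0; rewrite sq0 ltxx in sq.
Qed.

(** On the edge of the entering variable [q], the slack sees the coordinate [q]
only. *)
Lemma dot_entering B s q y :
  is_slack B s -> supported (q |: B) y -> dot s y = s q 0 * y q 0.
Proof.
move=> [sB _ _] yq; rewrite /dot (bigD1 q) //= big1 ?addr0 // => j jq.
have [jB|jN] := boolP (j \in B); first by rewrite sB // mul0r.
by rewrite yq ?mulr0 // !inE negb_or jq.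
Qed.

Lemma supported_move B q x d theta :
  supported B x -> supported (q |: B) d -> supported (q |: B) (x + theta *: d).
Proof.
move=> xB dB j jN; rewrite !mxE dB // mulr0 addr0 xB //.
by apply: contraNN jN => jB; rewrite !inE jB orbT.
Qed.

(** The step length is positive because the leaving variable was positive and
becomes zero.  For the same reason the direction does not vanish at the leaving
variable [i], which is what keeps the new columns independent: a dependency
among them is a multiple of the direction, and it vanishes at [i]. *)
Lemma pivot_step B x s (k : 'I_#|~: B|) B' x' :
  lp_nondegenerate A b -> bfs_of A b B x -> is_slack B s ->
  pivot A b k B' x' ->
  [/\ bfs_of A b B' x', 0 < x' (enum_val k) 0 &
    objective c x' = objective c x + s (enum_val k) 0 * x' (enum_val k) 0].
Proof.
move=> nondeg xB sP [theta [i [theta_ge0 [x'edge x'_ge0] [iB x'i] _ ->]]].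
set q := enum_val k; have qN : q \notin B := nonbasic_indexP k.
have basisB := bfs_of_basis xB; have cardB := is_basis_card basisB.
have [d dP] := edge_direction_exists k basisB.
move/(on_edgeP _ _ xB dP): x'edge => x'E; case: (dP) => Ad dq dN.
have [Ax x_ge0] := bfs_of_feasible xB; have xN := bfs_of_supported xB.
have x'N : supported (q |: B) x' by rewrite x'E; apply: supported_move.
have Ax' : A *m x' = b by rewrite x'E mulmxDr -scalemxAr Ad scaler0 addr0.
have x'q : x' q 0 = theta by rewrite x'E !mxE xN // dq mulr1 add0r.
have xi : 0 < x i 0 by apply: nondegenerate_pos xB iB.
have xid : x i 0 + theta * d i 0 = 0 by rewrite -x'i x'E !mxE.
have theta_gt0 : 0 < theta.
  rewrite lt_def theta_ge0 andbT; apply/eqP => theta0.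
  by move: xid xi; rewrite theta0 mul0r addr0 => ->; rewrite ltxx.
have di : d i 0 != 0.
  apply/eqP => di0.
  by move: xid xi; rewrite di0 mulr0 addr0 => ->; rewrite ltxx.
have iq : i != q by apply: contraNneq qN => <-.
split; last by rewrite (slack_objective sP xB Ax') (dot_entering sP x'N).
  apply/bfs_ofP; last first.
    split=> // j; rewrite !inE negb_or negb_and negbK => /andP[jq].
    case/orP=> [/eqP -> //|jB]; apply: x'N.
    by rewrite !inE negb_or jq.
  apply: free_is_basis => [|v vN Av].
    rewrite cardsU1 !inE (negPf qN) andbF /= add1n.
    by move: cardB; rewrite (cardsD1 i) iB add1n.
  (* the difference is a dependency among the columns of B *)
  have vE : v = v q 0 *: d.
    apply/eqP; rewrite -subr_eq0; apply/eqP; apply: (basis_free basisB).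
      move=> j jB; rewrite !mxE; have [->|jq] := eqVneq j q.
        by rewrite dq mulr1 subrr.
      rewrite dN ?inE ?negb_or ?jq // mulr0 subr0.
      by apply: vN; rewrite !inE negb_or jq /= (negPf jB) andbF.
    by rewrite mulmxBr -scalemxAr Ad scaler0 Av subr0.
  have vi : v i 0 = 0 by apply: vN; rewrite !inE negb_or iq eqxx.
  move: vi; rewrite vE !mxE => /eqP.
  rewrite mulf_eq0 (negPf di) orbF => /eqP ->.
  by rewrite scale0r.
by rewrite x'q.
Qed.

(** The ratio test.  If no basic variable decreases along the edge, the edge is
an unbounded ray on which the objective tends to minus infinity, which the
existence of an optimum excludes. *)
Lemma pivot_exists B x s (k : 'I_#|~: B|) :
  (exists xopt, optimal A b c xopt) ->
  bfs_of A b B x -> is_slack B s -> s (enum_val k) 0 < 0 ->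
  exists B' x', pivot A b k B' x'.
Proof.
move=> [xopt [_ xopt_min]] xB sP; set q := enum_val k => sq.
have qN : q \notin B := nonbasic_indexP k.
have [d dP] := edge_direction_exists k (bfs_of_basis xB).
case: (dP) => Ad dq dN.
have [Ax x_ge0] := bfs_of_feasible xB; have xN := bfs_of_supported xB.
have edgeA theta : A *m (x + theta *: d) = b.
  by rewrite mulmxDr -scalemxAr Ad scaler0 addr0.
have [/existsP [i0 di0]|/existsPn d_ge0] := boolP [exists i, d i 0 < 0].
  pose ratio i := x i 0 / - d i 0.
  case: (@Order.TotalTheory.arg_minP _ _ _ i0 (fun i => d i 0 < 0) ratio di0).
  move=> i di i_min; have iB : i \in B.
    apply/negPn/negP => iN; have [iq|iq] := eqVneq i q.
      by move: di; rewrite iq dq ltr10.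
    by move: di; rewrite dN ?ltxx // !inE negb_or iq.
  have d_gt0 : 0 < - d i 0 by rewrite oppr_gt0.
  exists (q |: (B :\ i)), (x + ratio i *: d); exists (ratio i), i; split=> //.
  - by rewrite /ratio divr_ge0 // ltW.
  - split; first exact/(on_edgeP _ _ xB dP).
    move=> j; rewrite !mxE; have [dj|dj] := ltP (d j 0) 0; last first.
      by rewrite addr_ge0 // mulr_ge0 // /ratio divr_ge0 // ltW.
    have /= := i_min j dj; rewrite {2}/ratio ler_pdivlMr ?oppr_gt0 // => h.
    by rewrite -[d j 0]opprK mulrN subr_ge0.
  - by split=> //; rewrite !mxE /ratio; field; rewrite lt_eqF.
  - move=> theta y theta_gt /(on_edgeP _ _ xB dP) ->; rewrite !mxE.
    move: theta_gt; rewrite /ratio ltr_pdivrMr // mulrN.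
    by rewrite -subr_lt0 opprK.
exfalso.
have d_ge0' i : 0 <= d i 0 by have := d_ge0 i; rewrite -leNgt.
(* the step after which the objective is exactly 1 below the optimum *)
pose theta := (objective c x - objective c xopt + 1) / - s q 0.
have x_opt : objective c xopt <= objective c x by apply: xopt_min.
have theta_ge0 : 0 <= theta by rewrite /theta divr_ge0 //; lra.
have feas : feasible A b (x + theta *: d).
  by split=> // j; rewrite !mxE addr_ge0 // mulr_ge0.
have := xopt_min _ feas.
rewrite (slack_objective sP xB (edgeA _)).
rewrite (dot_entering sP (supported_move theta xN dN)) !mxE (xN q) // dq.
have -> : s q 0 * (0 + theta * 1) = objective c xopt - objective c x - 1.
  by rewrite /theta; field; rewrite lt_eqF.
by move=> h; lra.
Qed.

End Bases.

(** * Progress of one iteration *)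

Section Progress.
Variables (R : realType) (m n : nat).
Variables (A : 'M[R]_(m, n)) (b : 'cV[R]_m) (c : 'cV[R]_n).
Hypothesis nondeg : lp_nondegenerate A b.
Hypothesis has_opt : exists xopt, optimal A b c xopt.
Implicit Types (B : {set 'I_n}) (x y s : 'cV[R]_n).

(** A minimizer of the objective among the basic feasible solutions has a
nonnegative slack, since otherwise a pivot would improve it.  This gives an
optimal solution and an optimal dual solution at once. *)
Lemma optimal_bfs_exists B0 x0 :
  bfs_of A b B0 x0 ->
  exists B x s, [/\ bfs_of A b B x, is_slack A b c B s & forall j, 0 <= s j 0].
Proof.
move=> x0B.
have [B [x [xB x_min]]] :
    exists B x, bfs_of A b B x /\
      forall B' y, bfs_of A b B' y -> objective c x <= objective c y.
  by apply: finite_argmin => [B x y|]; [exact: bfs_of_inj|exists B0, x0].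
have [s sP] := slack_exists b c (bfs_of_basis xB).
exists B, x, s; split=> // j; rewrite leNgt; apply/negP => sj.
have [k jk] := nonbasic_index_onto (is_slack_out sP sj); rewrite jk in sj.
have [B' [x' x'P]] := pivot_exists has_opt xB sP sj.
have [x'B xk objE] := pivot_step nondeg xB sP x'P.
have := x_min _ _ x'B; rewrite objE lerDl.
by rewrite leNgt nmulr_rlt0 // xk.
Qed.

Lemma dantzig_index_exists B :
  ~ stopping_test A c B ->
  exists2 k, reduced_cost A c B k 0 < 0 &
    forall l, reduced_cost A c B k 0 <= reduced_cost A c B l 0.
Proof.
move=> /existsNP [k0 /negP]; rewrite -ltNge => k0_lt0.
case: (@Order.TotalTheory.arg_minP _ _ _ k0 predT
  (fun k => reduced_cost A c B k 0) isT) => k _ k_min.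
exists k => [|l]; last exact: k_min.
by apply: le_lt_trans k0_lt0; apply: k_min.
Qed.

Lemma dantzig_pivot_exists B x :
  bfs_of A b B x -> ~ stopping_test A c B ->
  exists (k : 'I_#|~: B|) B' x',
    pivot A b k B' x' /\ rule_ok A b c MostNegative k x'.
Proof.
move=> xB nstop; have [s sP] := slack_exists b c (bfs_of_basis xB).
have [k k_lt0 k_min] := dantzig_index_exists nstop.
have sk : s (enum_val k) 0 < 0 by case: (sP) => _ <-.
have [B' [x' x'P]] := pivot_exists has_opt xB sP sk.
by exists k, B', x'.
Qed.

(** For the best improvement rule, the pivots from [B] are compared through the
bases that they lead to, which are finitely many and determine the next
iterate. *)
Lemma iteration_exists rule B x :
  bfs_of A b B x -> ~ stopping_test A c B ->
  exists B' x', iteration A b c rule B B' x'.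
Proof.
move=> xB nstop; have [k [B' [x' [x'P x'ok]]]] := dantzig_pivot_exists xB nstop.
case: rule; first by exists B', x'; split=> //; exists k.
have [s sP] := slack_exists b c (bfs_of_basis xB).
have bfsP B'' x'' (l : 'I_#|~: B|) : pivot A b l B'' x'' -> bfs_of A b B'' x''.
  by case/(pivot_step nondeg xB sP).
have [B1 [x1 [[l x1P] x1_min]]] :
    exists B1 x1, (exists l : 'I_#|~: B|, pivot A b l B1 x1) /\
      forall B2 x2, (exists l : 'I_#|~: B|, pivot A b l B2 x2) ->
        objective c x1 <= objective c x2.
  apply: finite_argmin => [B2 y z [l /bfsP yB] [l' /bfsP zB]|].
    exact: bfs_of_inj yB zB.
  by exists B', x', k.
exists B1, x1; split=> //; exists l; split=> // l2 B2 x2 x2P.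
by apply: (x1_min B2); exists l2.
Qed.

Variables delta gamma : R.
Hypothesis m_gt0 : (0 < m)%N.
Hypothesis delta_gt0 : 0 < delta.
Hypothesis delta_lb :
  forall B x j, bfs_of A b B x -> 0 < x j 0 -> delta <= x j 0.
Hypothesis gamma_ub : forall B x j, bfs_of A b B x -> x j 0 <= gamma.
Variables (Bs : {set 'I_n}) (xs ss : 'cV[R]_n).
Hypothesis xsB : bfs_of A b Bs xs.
Hypothesis ssP : is_slack A b c Bs ss.
Hypothesis ss_ge0 : forall j, 0 <= ss j 0.

Definition gap x : R := objective c x - objective c xs.

Lemma gap_slack x : A *m x = b -> gap x = dot ss x.
Proof. by move=> Ax; rewrite /gap (slack_objective ssP xsB Ax) addrC addKr. Qed.

Lemma gap_ge0 B x : bfs_of A b B x -> 0 <= gap x.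
Proof.
by move=> /bfs_of_feasible [Ax x_ge0]; rewrite gap_slack //; apply: dot_ge0.
Qed.

Lemma sum_bfs_le B x : bfs_of A b B x -> \sum_j x j 0 <= m%:R * gamma.
Proof.
move=> xB; rewrite (bigID (mem B)) /= [X in _ + X]big1 ?addr0; last first.
  by move=> j; apply: bfs_of_supported xB j.
apply: le_trans (ler_sum _ (fun j _ => gamma_ub j xB)) _.
rewrite sumr_const mulr_natl.
by have -> : #|mem B| = m by exact: is_basis_card (bfs_of_basis xB).
Qed.

(** Moving from [x] to the optimal [xs] changes the objective by the inner
product of [s] and [xs], and the entries of [xs] add up to at most
[m gamma]. *)
Lemma gap_reduced_cost B x s r :
  bfs_of A b B x -> is_slack A b c B s -> 0 <= r -> (forall j, - r <= s j 0) ->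
  gap x <= r * (m%:R * gamma).
Proof.
move=> xB sP r_ge0 r_s; have [Axs xs_ge0] := bfs_of_feasible xsB.
rewrite /gap (slack_objective sP xB Axs) opprD addNKr.
apply: le_trans (ler_wpM2l r_ge0 (sum_bfs_le xsB)).
rewrite lerNl -mulNr mulr_sumr; apply: ler_sum => j _.
exact: ler_wpM2r.
Qed.

(** The second inequality is the contraction by [1 - delta / (m gamma)], with
the denominators cleared. *)
Lemma dantzig_pivot_progress B x (k : 'I_#|~: B|) B' x' :
  bfs_of A b B x -> ~ stopping_test A c B ->
  pivot A b k B' x' -> rule_ok A b c MostNegative k x' ->
  gap x' < gap x /\ gap x' * (m%:R * gamma) <= gap x * (m%:R * gamma - delta).
Proof.
move=> xB nstop x'P k_min.
have [s sP] := slack_exists b c (bfs_of_basis xB).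
have [x'B x'k objE] := pivot_step nondeg xB sP x'P.
case: (sP) => sB sN _.
have sk : s (enum_val k) 0 < 0.
  rewrite -sN; have [l l_lt0 _] := dantzig_index_exists nstop.
  exact: le_lt_trans (k_min l) l_lt0.
have sk_min j : - - s (enum_val k) 0 <= s j 0.
  rewrite opprK; have [jB|/nonbasic_index_onto [l ->]] := boolP (j \in B).
    by rewrite (sB _ jB) ltW.
  by rewrite -!sN; apply: k_min.
have r_gt0 : 0 < - s (enum_val k) 0 by rewrite oppr_gt0.
have bound := gap_reduced_cost xB sP (ltW r_gt0) sk_min.
have xk := delta_lb x'B x'k.
have gapE : gap x' = gap x - - s (enum_val k) 0 * x' (enum_val k) 0.
  by rewrite /gap objE; ring.
move: bound r_gt0; rewrite gapE; move: (- s _ _) => r bound r_gt0.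
split; first by rewrite ltrBlDr ltrDl mulr_gt0.
rewrite mulrBl mulrBr lerD2l lerN2 mulrAC.
apply: le_trans (ler_wpM2r (ltW delta_gt0) bound) _.
apply: ler_wpM2l xk; apply: le_trans bound.
exact: gap_ge0 xB.
Qed.

(** Best improvement inherits the bound of the most negative rule, as its next
objective value is at most the one that rule would reach. *)
Lemma iteration_progress rule B x B' x' :
  bfs_of A b B x -> iteration A b c rule B B' x' ->
  [/\ bfs_of A b B' x', gap x' < gap x &
    gap x' * (m%:R * gamma) <= gap x * (m%:R * gamma - delta)].
Proof.
move=> xB [nstop [k [x'P x'ok]]].
have [s sP] := slack_exists b c (bfs_of_basis xB).
have [x'B _ _] := pivot_step nondeg xB sP x'P.
case: rule x'ok => [x'ok|x'_min].
  by have [] := dantzig_pivot_progress xB nstop x'P x'ok.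
have [l [B2 [x2 [x2P x2ok]]]] := dantzig_pivot_exists xB nstop.
have [x2_lt x2_le] := dantzig_pivot_progress xB nstop x2P x2ok.
have x'_x2 : gap x' <= gap x2 by rewrite lerB // (x'_min l B2).
split=> //; first exact: le_lt_trans x2_lt.
apply: le_trans x2_le; apply: ler_wpM2r x'_x2.
apply: le_trans (sum_bfs_le xsB); apply: sumr_ge0 => j _.
by have [] := bfs_of_feasible xsB.
Qed.

(** The variable [j] is one with at least an average share of the gap.  Keeping
it positive, hence at least [delta], would cost [ss_j delta], and
[ss_j >= gap x / (m gamma)]. *)
Lemma vanishing_variable B x :
  bfs_of A b B x -> 0 < gap x ->
  exists2 j, 0 < x j 0 &
    forall B' y, bfs_of A b B' y -> gap y * (m%:R * gamma) < gap x * delta ->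
      y j 0 = 0.
Proof.
move=> xB gap_gt0; have [Ax x_ge0] := bfs_of_feasible xB.
have cardB := is_basis_card (bfs_of_basis xB).
have [j jB big_j] : exists2 j, j \in B & gap x <= m%:R * (ss j 0 * x j 0).
  apply/exists2P; apply: contrapT => /forallNP all_small.
  suff : m%:R * gap x < \sum_(j in B) gap x.
    by rewrite sumr_const cardB mulr_natl ltxx.
  rewrite {1}(gap_slack Ax) /dot (bigID (mem B)) /= [X in _ + X]big1 ?addr0.
    rewrite mulr_sumr; apply: ltr_sum.
      have /card_gt0P [j jB] : (0 < #|B|)%N by rewrite cardB.
      by apply/hasP; exists j; rewrite ?mem_index_enum.
    by move=> j jB; rewrite ltNge; apply/negP => big_j; apply: (all_small j).
  by move=> j jN; rewrite (bfs_of_supported xB) ?mulr0.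
have xj : 0 < x j 0 := nondegenerate_pos nondeg xB jB.
exists j => // B' y yB gap_y; have [Ay y_ge0] := bfs_of_feasible yB.
apply/eqP; rewrite eq_le y_ge0 andbT leNgt; apply/negP => yj.
have ssj_y : ss j 0 * y j 0 <= gap y.
  rewrite (gap_slack Ay) /dot (bigD1 j) //= lerDl.
  by apply: sumr_ge0 => i _; rewrite mulr_ge0.
have ssj_delta : ss j 0 * delta <= gap y.
  by apply: le_trans ssj_y; rewrite ler_wpM2l // (delta_lb yB).
have gap_x : gap x <= ss j 0 * (m%:R * gamma).
  apply: le_trans big_j _; rewrite mulrCA ler_wpM2l // ler_wpM2l //.
  exact: gamma_ub xB.
have mg_ge0 : 0 <= m%:R * gamma.
  rewrite mulr_ge0 //; apply: le_trans (gamma_ub j xB); exact: ltW.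
have := ler_wpM2r (ltW delta_gt0) gap_x.
have := ler_wpM2r mg_ge0 ssj_delta.
rewrite mulrAC => h1 h2.
by have := le_lt_trans (le_trans h2 h1) gap_y; rewrite ltxx.
Qed.

End Progress.

(** * Counting the iterations *)

(** From [1 - 1/k <= exp (- 1/k)], the power is at most [exp (- r/k)], which is
less than [exp (- ln k)]. *)
Lemma pow_decay (R : realType) (k : R) (r : nat) :
  1 <= k -> k * ln k < r%:R -> (1 - k^-1) ^+ r * k < 1.
Proof.
move=> k_ge1 kr; have k_gt0 : 0 < k by apply: lt_le_trans k_ge1.
have q_ge0 : 0 <= 1 - k^-1 by rewrite subr_ge0 invf_le1.
have : (1 - k^-1) ^+ r <= expR (- (r%:R / k)).
  rewrite -mulrN expRM_natl; apply: lerXn2r; rewrite ?nnegrE ?expR_ge0 //.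
  exact: expR_ge1Dx.
move=> /(ler_wpM2r (ltW k_gt0)) /le_lt_trans; apply.
rewrite -{2}(lnK (x := k)) ?posrE // -expRD expR_lt1.
by rewrite addrC subr_lt0 ltr_pdivlMr // mulrC.
Qed.

(** If more than [n r] steps were taken, the steps [0, r, ..., n r] would each
provide an index that is alive then and dead at the later ones, so that these
[n + 1] indices would be distinct. *)
Lemma phase_count (n r T : nat) (alive : nat -> 'I_n -> Prop) :
  (forall t, (t < T)%N -> exists j, alive t j /\
     forall t', (t + r <= t')%N -> (t' <= T)%N -> ~ alive t' j) ->
  (T <= n * r)%N.
Proof.
move=> dies; rewrite leqNgt; apply/negP => nrT.
have ltT (i : 'I_n.+1) : (i * r < T)%N.
  by apply: leq_ltn_trans nrT; rewrite leq_mul2r -ltnS ltn_ord orbT.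
have [f fP] := choice (fun i : 'I_n.+1 => dies _ (ltT i)).
have f_lt (i i' : 'I_n.+1) : (i < i')%N -> f i != f i'.
  move=> ii'; apply/eqP => fE; have [_ dead] := fP i.
  apply: (dead (i' * r)%N) (ltnW (ltT i')) _.
    by rewrite addnC -mulSn leq_mul2r ii' orbT.
  by rewrite fE; have [] := fP i'.
have f_inj : injective f.
  move=> i i' fE; apply: val_inj; case: (ltngtP i i') => // /f_lt.
    by rewrite fE eqxx.
  by rewrite fE eqxx.
by have := leq_card f f_inj; rewrite !card_ord ltnn.
Qed.

Theorem corollary3p3 (R : realType) (m n : nat)
    (A : 'M[R]_(m, n)) (b : 'cV[R]_m) (c : 'cV[R]_n)
    (rankA : \rank A = m)
    (has_opt : exists xopt : 'cV[R]_n, optimal A b c xopt)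
    (delta gamma : R)
    (delta_min : bfs_positive_elements A b delta /\
                 lbound (bfs_positive_elements A b) delta)
    (gamma_max : bfs_positive_elements A b gamma /\
                 ubound (bfs_positive_elements A b) gamma)
    (nondeg : lp_nondegenerate A b)
    (rule : pivot_rule) (x0 : 'cV[R]_n) (x0_bfs : bfs A b x0) :
  finds_optimal_within A b c rule x0
    (n%:Z * strict_ceil (m%:R * (gamma / delta) *
                         ln (m%:R * (gamma / delta)))).
Proof.
case: delta_min => -[delta_gt0 [xd [jd [[Bd xdB] xdE]]]] delta_lb.
case: gamma_max => -[gamma_gt0 _] gamma_ub.
have m_gt0 : (0 < m)%N.
  rewrite -(is_basis_card (bfs_of_basis xdB)); apply/card_gt0P; exists jd.
  apply/negPn/negP => /(bfs_of_supported xdB) xd0.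
  by rewrite xdE xd0 ltxx in delta_gt0.
have lb B x j : bfs_of A b B x -> 0 < x j 0 -> delta <= x j 0.
  move=> xB xj; apply: delta_lb; split=> //.
  by exists x, j; split=> //; exists B.
have ub B x j : bfs_of A b B x -> x j 0 <= gamma.
  move=> xB; have [xj|xj] := ltP 0 (x j 0); last exact: le_trans xj (ltW _).
  by apply: gamma_ub; split=> //; exists x, j; split=> //; exists B.
have delta_le_gamma : delta <= gamma.
  by rewrite xdE; apply: ub xdB.
set k := m%:R * (gamma / delta).
have k_ge1 : 1 <= k.
  by rewrite /k mulr_ege1 ?ler1n // ler_pdivlMr // mul1r.
have k_gt0 : 0 < k by apply: lt_le_trans k_ge1.
have [r rE] : exists r : nat, strict_ceil (k * ln k) = r%:Z.
  have : 0 <= strict_ceil (k * ln k).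
    rewrite /strict_ceil addr_ge0 // floor_ge0.
    by rewrite mulr_ge0 ?ln_ge0 // ltW.
  by case: (strict_ceil _) => // r _; exists r.
have kr : k * ln k < r%:R.
  by have := (strict_ceilP (k * ln k)).1; rewrite rE.
move=> T B x [_ x0B step].
have [Bs [xs [ss [xsB ssP ss_ge0]]]] := optimal_bfs_exists nondeg has_opt x0B.
have xB t : (t <= T)%N -> bfs_of A b (B t) (x t).
  elim: t => // t IHt tT; have xtB := IHt (ltnW tT).
  by have [k' [? [? _]]] := step t tT;
     have [] := iteration_progress nondeg has_opt delta_gt0 lb ub xsB ssP ss_ge0
       xtB (step t tT).
pose g t := gap c xs (x t).
have g_ge0 t : (t <= T)%N -> 0 <= g t.
  by move=> tT; apply: (gap_ge0 xsB ssP ss_ge0 (xB t tT)).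
have progress t (tT : (t < T)%N) :=
  iteration_progress nondeg has_opt delta_gt0 lb ub xsB ssP ss_ge0
    (xB t (ltnW tT)) (step t tT).
(* an iteration strictly lowers the gap, which stays nonnegative *)
have g_gt0 t : (t < T)%N -> 0 < g t.
  move=> tT; have [_ lt_g _] := progress t tT.
  exact: le_lt_trans (g_ge0 _ tT) lt_g.
pose q := 1 - k^-1.
have q_ge0 : 0 <= q by rewrite subr_ge0 invf_le1.
have q_le1 : q <= 1 by rewrite gerBl invr_ge0 ltW.
have mg_gt0 : 0 < m%:R * gamma by rewrite mulr_gt0 // ltr0n.
have contract t : (t < T)%N -> g t.+1 <= q * g t.
  move=> tT; have [_ _] := progress t tT; rewrite -ler_pdivlMr //.
  move=> h; apply: le_trans h _; rewrite le_eqVlt; apply/orP; left; apply/eqP.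
  rewrite /q /k -/(g t); field.
  by rewrite !gt_eqF // ltr0n.
have decay t u : (t + u <= T)%N -> g (t + u)%N <= q ^+ u * g t.
  elim: u => [|u IHu]; first by rewrite addn0 expr0 mul1r.
  rewrite addnS => tu; apply: le_trans (contract _ tu) _.
  by rewrite exprS -mulrA ler_wpM2l // IHu // ltnW.
have qrk := pow_decay k_ge1 kr.
split; last 2 first.
- exact: stopping_optimal (xB T (leqnn T)).
- exact: (iteration_exists nondeg has_opt rule (xB T (leqnn T))).
rewrite rE -PoszM lez_nat.
apply: (phase_count (alive := fun t j => 0 < x t j 0)) => t tT.
have [j xj dead] := vanishing_variable nondeg m_gt0 delta_gt0 lb ub xsB ssP
  ss_ge0 (xB t (ltnW tT)) (g_gt0 t tT).
exists j; split=> // t' tt' t'T.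
suff -> : x t' j 0 = 0 by rewrite ltxx.
apply: (dead _ _ (xB t' t'T)); rewrite -!/(g _).
have tt'le : (t <= t')%N := leq_trans (leq_addr _ _) tt'.
have := decay t (t' - t)%N; rewrite subnKC // => /(_ t'T) gu.
have qu : q ^+ (t' - t) <= q ^+ r by rewrite ler_wiXn2l // leq_subRL.
have gr : g t' <= q ^+ r * g t.
  by apply: le_trans gu _; rewrite ler_wpM2r // ltW // g_gt0.
have -> : m%:R * gamma = k * delta by rewrite /k; field; rewrite gt_eqF.
rewrite mulrA ltr_pM2r //.
apply: le_lt_trans (ler_wpM2r (ltW k_gt0) gr) _.
by rewrite mulrAC gtr_pMl // g_gt0.
Qed.
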